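(* Let $n,m$ be coprime positive integers, let $b\in\mathbb{C}$, $c\in\mathbb{C}\setminus\{0\}$, $\gamma=\arg c$, let $h(z)=z^{n+m}+b\,\overline{z}^{\,m}+c$, let $v>0$ be a real number, and let $$T_v(\phi)=v^n e^{i(n+2m)\phi}+|c|\,v^{-m}e^{i(\gamma+m\phi)},\qquad \phi\in[0,2\pi).$$ Then there exist consecutive roots $z_j,z_{j+1}$ of $h$ (in the ordering by norm, a root of multiplicity two being allowed as $z_j=z_{j+1}$) with $|z_j|=|z_{j+1}|=v$ if and only if $-b$ is a singular point of the trochoid $T_v$. In particular: \begin{enumerate} \item $h$ has two distinct roots with the same modulus $v$ if and only if $-b$ is a double point of the trochoid $T_v$. \item $h$ has a root of multiplicity two with modulus $v$ if and only if there is $\phi\in[0,2\pi)$ such that $-b$ is a cusp of $T_v$ at parameter $\phi$ and $b=\frac{n+m}{m}\,v^n e^{i(n+2m)\phi}$. \item If $n>m$, then $h$ has more than two roots with modulus $v$ if and only if $b=0$, which holds if and only if the trochoid $T_v$ is a rhodonea (rose) curve with a point of multiplicity $n+m$ at the origin. \end{enumerate}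
   Context: For $\phi\in[0,2\pi)$ one has $v^{-m}e^{im\phi}\,h(ve^{i\phi})=b+T_v(\phi)$; the left-hand side is denoted $h^v(\phi)$ in the source, so the trochoid is the curve $h^v-b=T_v$, and roots of $h$ of modulus $v$ correspond to parameters $\phi$ with $T_v(\phi)=-b$. A point $p\in\mathbb{C}$ is a double point of $T_v$ if $T_v(\phi)=T_v(\varphi)=p$ for two distinct $\phi,\varphi\in[0,2\pi)$; it is a cusp of $T_v$ at parameter $\phi$ if $T_v(\phi)=p$ and $\frac{d}{d\phi}T_v(\phi)=0$; a singular point is a double point or a cusp. A root $\zeta=ve^{i\phi}$ of $h$ is of multiplicity two with modulus $v$ if $h(ve^{i\phi})=0$ and $\frac{\partial}{\partial\phi}h(ve^{i\phi})=0$. The curve has a point of multiplicity $n+m$ at the origin if it takes the value $0$ for $n+m$ distinct parameters in $[0,2\pi)$.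
   Formalization: Item 3 fails for arbitrary fixed v (b=0, v^{n+m}≠|c|: no such roots; b≠0, v^{n+m}=|c|: T_v is still a rose). It is proved when v is the modulus of a root of h, and also for some modulus, with −b too required to be a point of multiplicity n+m of the rose. *)

(* Defs.v *)
From mathcomp Require Import all_boot all_order all_algebra.
From mathcomp Require Import complex.
From mathcomp Require Import boolp classical_sets reals topology normedtype derive trigo.

Set Implicit Arguments.
Unset Strict Implicit.
Unset Printing Implicit Defensive.

Import Order.TTheory GRing.Theory Num.Theory.
Import numFieldNormedType.Exports.

Local Open Scope classical_set_scope.
Local Open Scope ring_scope.
Local Open Scope complex_scope.

Definition expi (R : realType) (t : R) : R[i] := cos t +i* sin t.

(* Derivative of a complex-valued function of a real variable, taken
   componentwise: R[i] carries no normed module structure over R. *)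
Definition is_cderive (R : realType) (f : R -> R[i]) (t : R) (d : R[i]) : Prop :=
  is_derive t (1 : R) (fun x => complex.Re (f x)) (complex.Re d) /\
  is_derive t (1 : R) (fun x => complex.Im (f x)) (complex.Im d).

Definition trinomial (R : realType) (n m : nat) (b c z : R[i]) : R[i] :=
  z ^+ (n + m) + b * (z^*) ^+ m + c.

(* gamma is meant to be an argument of c. *)
Definition trochoid (R : realType) (n m : nat) (c : R[i]) (gamma v t : R) : R[i] :=
  v%:C ^+ n * expi ((n + 2 * m)%:R * t)
  + `|c| * v%:C ^- m * expi (gamma + m%:R * t).

Definition double_point (R : realType) (T : R -> R[i]) (p : R[i]) : Prop :=
  exists t u : R,
    [/\ 0 <= t < 2 * pi, 0 <= u < 2 * pi, t != u, T t = p & T u = p].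

Definition cusp_at (R : realType) (T : R -> R[i]) (p : R[i]) (t : R) : Prop :=
  T t = p /\ is_cderive T t 0.

Definition singular_point (R : realType) (T : R -> R[i]) (p : R[i]) : Prop :=
  double_point T p \/ exists t : R, 0 <= t < 2 * pi /\ cusp_at T p t.

Definition multiple_point (R : realType) (T : R -> R[i]) (k : nat) (p : R[i]) : Prop :=
  exists s : seq R,
    [/\ uniq s, size s = k
      & forall t, t \in s -> 0 <= t < 2 * pi /\ T t = p].

(* The trace of T is, up to a rotation about the origin, the curve with polar
   equation r = a cos (k theta); k need not be an integer. *)
Definition rhodonea (R : realType) (T : R -> R[i]) : Prop :=
  exists a k t0 : R,
    [/\ 0 < a, 0 < k
      & T @` [set t | 0 <= t < 2 * pi]
        = range (fun t : R => (a * cos (k * t))%:C * expi (t + t0))].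

(* The derivative is the one in the angular variable. *)
Definition mult2_root (R : realType) (h : R[i] -> R[i]) (z : R[i]) : Prop :=
  exists r t : R,
    [/\ 0 < r, 0 <= t < 2 * pi, z = r%:C * expi t, h z = 0
      & is_cderive (fun x => h (r%:C * expi x)) t 0].

(* s lists all roots of h by nondecreasing modulus, the roots of multiplicity
   two twice and the others once. *)
Definition root_ordering (R : realType) (h : R[i] -> R[i]) (s : seq R[i]) : Prop :=
  sorted (fun z w : R[i] => `|z| <= `|w|) s /\
  forall z : R[i],
    count_mem z s = if h z != 0 then 0%N else if `[< mult2_root h z >] then 2%N else 1%N.

Definition consecutive_roots (R : realType) (h : R[i] -> R[i]) (z w : R[i]) : Prop :=
  exists (s : seq R[i]) (j : nat),
    [/\ root_ordering h s, (j.+1 < size s)%N, nth 0 s j = z & nth 0 s j.+1 = w].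

Definition more_than_two_roots (R : realType) (h : R[i] -> R[i]) (v : R) : Prop :=
  exists s : seq R[i],
    [/\ uniq s, (2 < size s)%N
      & forall z, z \in s -> h z = 0 /\ `|z| = v%:C].

(* T is a rose with a k-fold point at the origin, and -b is that k-fold point.
   The link with -b has to be stated because a trochoid does not depend on b. *)
Definition rose_at_origin (R : realType) (T : R -> R[i]) (k : nat) (b : R[i]) : Prop :=
  [/\ rhodonea T, multiple_point T k 0 & multiple_point T k (- b)].

(* Main.v *)
Require Import Defs.
From mathcomp Require Import all_boot all_order all_algebra.
From mathcomp Require Import complex.
From mathcomp Require Import boolp classical_sets reals topology normedtype.
From mathcomp Require Import derive realfun trigo.
From mathcomp Require Import ring lra.
Import Order.TTheory GRing.Theory Num.Theory.
Import numFieldNormedType.Exports.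
Local Open Scope ring_scope.
Local Open Scope complex_scope.

(* On the circle of modulus v, h(v e^(it)) = v^m e^(-imt) (b + T_v(t)) with a
   nonvanishing factor, so roots and multiplicities of h translate to values and
   stationary points of T_v.  The roots can be listed because eliminating the
   conjugate of z shows that they are finite in number.  A point p <> 0 is the sum
   of complex numbers of two prescribed moduli in at most two ways, and since n + 2m
   and m are coprime each way comes from one parameter; hence T_v passes more than
   twice only through 0.  When b = 0 the two terms of T_v have the same modulus and
   their sum is the product of a cosine and a unit vector, which is a rose. *)

(** * The unit circle and polar form *)

Section Expi.
Context {R : realType}.
Implicit Types (t u x : R) (z w a : R[i]).

Lemma expi0 : expi (0 : R) = 1.
Proof. by rewrite /expi cos0 sin0. Qed.

Lemma expiD t u : expi (t + u) = expi t * expi u.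
Proof. by rewrite /expi cosD sinD; simpc; rewrite [sin t * _ + _]addrC. Qed.

Lemma expi_neq0 t : expi t != 0.
Proof.
apply/eqP => e0; have := expiD t (- t).
by rewrite subrr expi0 e0 mul0r => /eqP; rewrite oner_eq0.
Qed.

Lemma expiN t : expi (- t) = (expi t)^-1.
Proof.
apply: (mulfI (expi_neq0 t)).
by rewrite -expiD subrr expi0 divff // expi_neq0.
Qed.

Lemma expi_natM n t : expi (n%:R * t) = expi t ^+ n.
Proof.
elim: n => [|n IH]; first by rewrite mul0r expi0.
by rewrite exprS -IH -expiD -{2}[t]mul1r -mulrDl -natr1 [1 + _]addrC.
Qed.

Lemma conj_expi t : (expi t)^*%R = (expi t)^-1.
Proof. by rewrite -expiN /expi cosN sinN. Qed.

Lemma norm_expi t : `|expi t| = 1.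
Proof. by rewrite normc_def /= cos2Dsin2 sqrtr1. Qed.

Lemma expi_pi : expi (pi : R) = -1.
Proof. by rewrite /expi cospi sinpi; simpc. Qed.

Lemma expi_2pi : expi (2 * pi : R) = 1.
Proof. by rewrite mulr_natl mulr2n expiD expi_pi mulrNN mulr1. Qed.

(** For [0 < t < 2 * pi] the half angle has positive sine, and the double-angle formula then keeps
    [cos t] below 1. *)
Lemma expi_eq1 t : 0 <= t < 2 * pi -> expi t = 1 -> t = 0.
Proof.
move=> /andP[t0 tpi] [c1 _]; apply/eqP; rewrite eq_le t0 andbT leNgt.
apply/negP => tp.
have /sin_gt0_pi : 0 < t / 2 < pi by apply/andP; split; lra.
have := cos_mulr2n (t / 2); rewrite (_ : t / 2 *+ 2 = t); last by field.
rewrite c1; have := cos2Dsin2 (t / 2); nra.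
Qed.

Lemma expi_inj t u : 0 <= t < 2 * pi -> 0 <= u < 2 * pi ->
  expi t = expi u -> t = u.
Proof.
wlog tu : t u / t <= u.
  by move=> H; case: (lerP t u) => [/H//|/ltW/H H'] ? ? /esym/H' ->.
move=> /andP[t0 _] /andP[_ u1] E.
suff : u - t = 0 by lra.
apply: expi_eq1; first by apply/andP; split; lra.
by rewrite expiD expiN E divff // expi_neq0.
Qed.

Lemma expi_surj z : `|z| = 1 -> exists2 t, 0 <= t < 2 * pi & z = expi t.
Proof.
case: z => x y; rewrite normc_def /= => -[e].
have xy : x ^+ 2 + y ^+ 2 = 1.
  by rewrite -[LHS]sqr_sqrtr ?e ?expr1n // addr_ge0 // sqr_ge0.
have x1 : -1 <= x <= 1 by apply/andP; split; nra.
have sx : Num.sqrt (1 - x ^+ 2) = `|y|.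
  by rewrite -xy [x ^+ 2 + _]addrC addrK sqrtr_sqr.
have cx : cos (acos x) = x by apply: acosK; rewrite in_itv.
have p0 := @pi_gt0 R; have a0 := acos_ge0 x1; have a1 := acos_lepi x1.
have [y0|y0] := lerP 0 y.
  exists (acos x); first by apply/andP; split; lra.
  by rewrite /expi cx sin_acos // sx ger0_norm.
(* On the lower half circle the angle is [2 * pi - acos x]. Since [y < 0] excludes [x = 1], [acos x]
   is positive and the angle stays strictly below [2 * pi]. *)
have x2 : -1 <= x < 1 by apply/andP; split; nra.
have := acos_gt0 x2 => a2.
exists (2 * pi - acos x); first by apply/andP; split; lra.
by rewrite expiD expi_2pi mul1r /expi cosN sinN cx sin_acos // sx ltr0_norm // opprK.
Qed.

Lemma expi_reduce x : exists2 t, 0 <= t < 2 * pi & expi x = expi t.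
Proof. exact/expi_surj/norm_expi. Qed.

Lemma polarP v z : 0 < v -> `|z| = v%:C ->
  exists2 t, 0 <= t < 2 * pi & z = v%:C * expi t.
Proof.
move=> v0 zv.
have vn0 : v%:C != 0 :> R[i] by rewrite fmorph_eq0 gt_eqF.
have [|t tI E] := expi_surj (z / v%:C).
  by rewrite normrM normfV zv ger0_norm ?divff // ler0c ltW.
by exists t => //; rewrite -E mulrC divfK.
Qed.

Lemma norm_polar v t : 0 < v -> `|v%:C * expi t| = v%:C.
Proof. by move=> v0; rewrite normrM norm_expi mulr1 ger0_norm // ler0c ltW. Qed.

End Expi.

(** * Calculus of componentwise derivatives *)

Section ComplexDerivative.
Context {R : realType}.
Implicit Types (f g : R -> R[i]) (t k a : R) (z w d e : R[i]).

Lemma ReD z w : complex.Re (z + w) = complex.Re z + complex.Re w.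
Proof. by case: z w => ? ? [? ?]. Qed.

Lemma ImD z w : complex.Im (z + w) = complex.Im z + complex.Im w.
Proof. by case: z w => ? ? [? ?]. Qed.

Lemma ReM z w :
  complex.Re (z * w) = complex.Re z * complex.Re w - complex.Im z * complex.Im w.
Proof. by case: z w => ? ? [? ?]. Qed.

Lemma ImM z w :
  complex.Im (z * w) = complex.Re z * complex.Im w + complex.Im z * complex.Re w.
Proof. by case: z w => ? ? [? ?]. Qed.

Lemma is_cderive_unique f t d e : is_cderive f t d -> is_cderive f t e -> d = e.
Proof.
move=> [dr di] [er ei]; apply/eqP; rewrite eq_complex.
rewrite -(@derive_val _ _ _ _ _ _ _ dr) -(@derive_val _ _ _ _ _ _ _ di).
by rewrite (@derive_val _ _ _ _ _ _ _ er) (@derive_val _ _ _ _ _ _ _ ei) !eqxx.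
Qed.

Lemma is_cderive_cst z t : is_cderive (fun=> z) t 0.
Proof. by split; apply: is_derive_cst. Qed.

Lemma is_cderiveD f g t d e : is_cderive f t d -> is_cderive g t e ->
  is_cderive (fun x => f x + g x) t (d + e).
Proof.
move=> [dr di] [er ei].
by split; [rewrite ReD; under eq_fun do rewrite ReD
          | rewrite ImD; under eq_fun do rewrite ImD]; apply: is_deriveD.
Qed.

Lemma is_cderiveM f g t d e : is_cderive f t d -> is_cderive g t e ->
  is_cderive (fun x => f x * g x) t (d * g t + f t * e).
Proof.
move=> [dr di] [er ei]; split.
  rewrite ReD !ReM; under eq_fun do rewrite ReM.
  apply: (is_derive_eq (is_deriveB (is_deriveM dr er) (is_deriveM di ei))).
  by rewrite /GRing.scale /=; ring.
rewrite ImD !ImM; under eq_fun do rewrite ImM.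
apply: (is_derive_eq (is_deriveD (is_deriveM dr ei) (is_deriveM di er))).
by rewrite /GRing.scale /=; ring.
Qed.

Lemma is_cderiveZ z f t d : is_cderive f t d ->
  is_cderive (fun x => z * f x) t (z * d).
Proof.
move=> df; have := is_cderiveM _ _ _ _ _ (is_cderive_cst z t) df.
by rewrite mul0r add0r.
Qed.

(** The affine phase covers both terms of the trochoid as well as the factor [expi (- m%:R * t)]
    that relates it to the trinomial. *)
Lemma is_cderive_expi a k t :
  is_cderive (fun x => expi (a + k * x)) t ('i * k%:C * expi (a + k * t)).
Proof.
have dl : is_derive t (1 : R) (fun x : R => a + k * x) k.
  apply: (is_derive_eq (is_deriveD (is_derive_cst a t 1)
    (is_deriveZ k (is_derive_id t 1)))).
  by rewrite add0r /GRing.scale /= mulr1.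
split.
  apply: (is_derive_eq (is_derive1_comp (is_derive_cos _) dl)).
  by rewrite /expi; simpc; rewrite /= mulrC.
apply: (is_derive_eq (is_derive1_comp (is_derive_sin _) dl)).
by rewrite /expi; simpc; rewrite /= mulrC.
Qed.

End ComplexDerivative.

(** * Roots of modulus [v] against points of the trochoid *)

Section Correspondence.
Context {R : realType} (n m : nat) (b c : R[i]) (gamma : R).
Hypothesis hgamma : c = `|c| * expi gamma.
Implicit Types (v t : R) (z : R[i]).

(** On the unit circle conjugation is inversion, so the conjugate of [v%:C * expi t] is
    [v%:C / expi t] and the identity becomes one of rational functions. *)
Lemma trinomial_polar v t : 0 < v ->
  trinomial n m b c (v%:C * expi t)
  = v%:C ^+ m * expi (- (m%:R * t)) * (b + trochoid n m c gamma v t).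
Proof.
move=> v0; have V0 : v%:C != 0 :> R[i] by rewrite fmorph_eq0 gt_eqF.
have -> : trinomial n m b c (v%:C * expi t)
  = (v%:C * expi t) ^+ (n + m) + b * (v%:C / expi t) ^+ m + c.
  congr (_ + _ * _ ^+ m + _); rewrite -conj_expi -[in RHS](conjc_real v).
  exact: (rmorphM Num.conj).
rewrite /trochoid.
rewrite {1}hgamma expiN expiD !expi_natM !exprMn !exprD expr0 exprVn.
have := expf_neq0 m (expi_neq0 t); have := expf_neq0 m V0.
by move=> Vm0 Em0; field; rewrite Vm0 Em0.
Qed.

Lemma trinomial_eq0 v t : 0 < v ->
  trinomial n m b c (v%:C * expi t) = 0 <-> trochoid n m c gamma v t = - b.
Proof.
move=> v0; have V0 : v%:C != 0 :> R[i] by rewrite fmorph_eq0 gt_eqF.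
rewrite trinomial_polar //; split=> [/eqP|->]; last by rewrite subrr mulr0.
rewrite !mulf_eq0 (negPf (expf_neq0 _ V0)) (negPf (expi_neq0 _)) /=.
by rewrite addrC addr_eq0 => /eqP.
Qed.

Lemma is_cderive_trochoid v t :
  is_cderive (trochoid n m c gamma v) t
    ('i * ((n + 2 * m)%:R * (v%:C ^+ n * expi ((n + 2 * m)%:R * t))
           + m%:R * (`|c| * v%:C ^- m * expi (gamma + m%:R * t)))).
Proof.
have D1 := is_cderiveZ (v%:C ^+ n) _ _ _ (is_cderive_expi 0 (n + 2 * m)%:R t).
have D2 := is_cderiveZ (`|c| * v%:C ^- m) _ _ _ (is_cderive_expi gamma m%:R t).
have := is_cderiveD _ _ _ _ _ D1 D2; rewrite add0r !rmorph_nat.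
under eq_fun do rewrite add0r.
by congr is_cderive; ring.
Qed.

(** Product rule: where [b + T_v] vanishes, the derivative of the prefactor drops out, so the
    derivative of [h] is the nonzero prefactor times that of [T_v]. *)
Lemma cusp_mult2_root v t : 0 < v ->
  cusp_at (trochoid n m c gamma v) (- b) t
  <-> trinomial n m b c (v%:C * expi t) = 0 /\
      is_cderive (fun x => trinomial n m b c (v%:C * expi x)) t 0.
Proof.
move=> v0; rewrite /cusp_at -trinomial_eq0 //.
have V0 : v%:C != 0 :> R[i] by rewrite fmorph_eq0 gt_eqF.
have G := is_cderiveZ (v%:C ^+ m) _ _ _ (is_cderive_expi 0 (- m%:R) t).
split=> -[h0 D]; split=> //.
  have := is_cderiveM _ _ _ _ _ G (is_cderiveD _ _ _ _ _ (is_cderive_cst b t) D).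
  have /trinomial_eq0 -> // := h0.
  rewrite subrr addr0 !mulr0 addr0.
  by congr is_cderive; apply/funext => x; rewrite trinomial_polar // add0r mulNr.
have := is_cderive_trochoid v t; move: ('i * _) => d DT.
suff : v%:C ^+ m * expi (- m%:R * t) * d = 0.
  move/eqP; rewrite !mulf_eq0 (negPf (expf_neq0 _ V0)) (negPf (expi_neq0 _)) /=.
  by move/eqP <-.
have := is_cderiveM _ _ _ _ _ G (is_cderiveD _ _ _ _ _ (is_cderive_cst b t) DT).
have /trinomial_eq0 -> // := h0.
rewrite subrr add0r mulr0 !add0r => DF.
apply: (is_cderive_unique _ t _ _ _ D); move: DF.
by congr is_cderive; apply/funext => x; rewrite trinomial_polar // add0r mulNr.
Qed.

Lemma mult2_root_cusp v : 0 < v ->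
  (exists z, mult2_root (trinomial n m b c) z /\ `|z| = v%:C) <->
  (exists t, 0 <= t < 2 * pi /\ cusp_at (trochoid n m c gamma v) (- b) t).
Proof.
move=> v0; split=> [[z [[r [t [r0 tI zE h0 D]] zv]]]|[t [tI]]].
  (* The radius hidden in [mult2_root] is the modulus of [z], hence [v]. *)
  have rv : r = v by apply: complexI; rewrite -zv zE norm_polar.
  by exists t; split=> //; apply/cusp_mult2_root; rewrite -?rv -?zE.
case/cusp_mult2_root => // h0 D; exists (v%:C * expi t).
by rewrite norm_polar //; split=> //; exists v, t.
Qed.

(** With [X] and [Y] the two terms of the trochoid, stationarity reads [(n + 2m) X + m Y = 0] and
    the value reads [X + Y = - b]; eliminating [Y] gives [b]. *)
Lemma cusp_value v t : 0 < v -> (0 < m)%N ->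
  cusp_at (trochoid n m c gamma v) (- b) t ->
  b = (n + m)%:R / m%:R * v%:C ^+ n * expi ((n + 2 * m)%:R * t).
Proof.
move=> v0 m0 [T0 D].
have /eqP := is_cderive_unique _ _ _ _ (is_cderive_trochoid v t) D.
have i0 : 'i%C != 0 :> R[i] by rewrite eq_complex /= oner_eq0 andbF.
rewrite mulf_eq0 (negPf i0) /= -[b]opprK -T0 /trochoid.
set X := v%:C ^+ n * _; set Y := `|c| * _ * _ => /eqP.
have m1 : m%:R != 0 :> R[i] by rewrite pnatr_eq0 -lt0n.
move=> E; rewrite natrD (natrM _ 2) in E; apply: (mulfI m1).
rewrite -(mulrA (_ / _)) -/X natrD.
apply/eqP; rewrite -subr_eq0; apply/eqP.
transitivity (- ((n%:R + 2 * m%:R) * X + m%:R * Y)); last by rewrite E oppr0.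
by field.
Qed.

Lemma double_root_point v : 0 < v ->
  (exists z w, [/\ z != w, trinomial n m b c z = 0, trinomial n m b c w = 0,
     `|z| = v%:C & `|w| = v%:C])
  <-> double_point (trochoid n m c gamma v) (- b).
Proof.
move=> v0; have V0 : v%:C != 0 :> R[i] by rewrite fmorph_eq0 gt_eqF.
split=> [[z [w [zw hz hw zv wv]]]|[t [u [tI uI tu Tt Tu]]]].
  have [t tI tE] := polarP v z v0 zv; have [u uI uE] := polarP v w v0 wv.
  exists t, u; split=> //; first by apply: contra zw => /eqP E; rewrite tE uE E.
    by apply/trinomial_eq0; rewrite -?tE.
  by apply/trinomial_eq0; rewrite -?uE.
exists (v%:C * expi t), (v%:C * expi u).
rewrite !norm_polar //; split=> //; try exact/trinomial_eq0.
by apply: contra tu => /eqP /(mulfI V0) /(expi_inj _ _ tI uI) ->.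
Qed.

End Correspondence.

(** * Finiteness of the roots and their ordering by modulus *)

Section RootOrdering.
Context {R : realType}.
Implicit Types (h : R[i] -> R[i]) (s rs : seq R[i]) (z w : R[i]) (v : R).

(* With [y] the conjugate of [z] and [N = n + m], raising
   [b * y ^ m = - (z ^ N + c)] to the power [N] and substituting the conjugate
   equation for [y ^ N] eliminates [y]; the left-hand side then has degree
   [m ^ 2] in [z] and the right-hand side degree [N ^ 2]. *)
Lemma trinomial_finite_roots (n m : nat) (b c : R[i]) : (0 < n)%N ->
  exists rs, forall z, trinomial n m b c z = 0 -> z \in rs.
Proof.
move=> n0; set N := (n + m)%N; have mN : (m < N)%N by rewrite -addn1 addnC leq_add2r.
have N0 : (0 < N)%N by exact: leq_ltn_trans mN.
pose A : {poly R[i]} := 'X^N + c%:P.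
pose B : {poly R[i]} := b^*%R *: 'X^m + (c^*%R)%:P.
pose p := (- A) ^+ N - b ^+ N *: (- B) ^+ m.
have sB : (size (- B) <= m.+1)%N.
  rewrite size_polyN (leq_trans (size_polyD _ _)) // geq_max.
  rewrite (leq_trans (size_scale_leq _ _)) ?size_polyXn //.
  by rewrite (leq_trans (size_polyC_leq1 _)).
have sBm : (size (b ^+ N *: (- B) ^+ m) <= (m * m).+1)%N.
  apply: leq_trans (size_scale_leq _ _) _; apply: leq_trans (size_poly_exp_leq _ _) _.
  by rewrite ltnS leq_mul2r -subn1 leq_subLR add1n sB orbT.
have sA : (size ((- A) ^+ N)) = (N * N).+1.
  have A0 : - A != 0 by rewrite -size_poly_eq0 size_polyN size_XnaddC.
  rewrite -(prednK (n := size _)) ?lt0n ?size_poly_eq0 ?expf_neq0 //.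
  by rewrite size_exp size_polyN size_XnaddC.
have p0 : p != 0.
  apply/eqP => /eqP; rewrite subr_eq0 => /eqP E.
  by move: sBm; rewrite -E sA ltnS leqNgt ltn_mul.
have [rs E] := closed_field_poly_normal p.
exists rs => z hz; rewrite -root_prod_XsubC.
rewrite -(rootZ _ _ (a := lead_coef p)) ?lead_coef_eq0 //.
rewrite -E /root /p hornerD hornerN hornerZ !horner_exp !hornerN.
have E1 : - (z ^+ N + c) = b * z^*%R ^+ m.
  by apply/eqP; rewrite eq_sym -subr_eq0 opprK addrA [b * _ + _]addrC -hz.
have E2 : - (b^*%R * z ^+ m + c^*%R) = z^*%R ^+ N.
  apply/eqP; rewrite eq_sym -subr_eq0 opprK addrA -(rmorph0 Num.conj) -hz.
  by rewrite /trinomial !rmorphD !rmorphM !rmorphXn /= conjCK.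
rewrite /A /B !hornerE E1 E2 exprMn -!exprM mulnC subrr //.
Qed.

(** The distinct roots, followed by a second copy of those of multiplicity two, are sorted by
    modulus. *)
Lemma root_ordering_exists h :
  (exists rs, forall z, h z = 0 -> z \in rs) -> exists s, root_ordering h s.
Proof.
move=> [rs hrs].
pose s0 := undup [seq z <- rs | h z == 0].
pose s1 := [seq z <- s0 | `[< mult2_root h z >]].
have m0 z : (z \in s0) = (h z == 0).
  by rewrite mem_undup mem_filter; case: eqP => // /hrs ->.
exists (sort (fun z w : R[i] => `|z| <= `|w|) (s0 ++ s1)); split.
  by apply: sort_sorted => z w; apply: real_leVge; exact: normr_real.
move=> z; rewrite count_sort count_cat !count_uniq_mem ?filter_uniq ?undup_uniq //.
rewrite mem_filter m0; case: eqP => _ //=; last by rewrite andbF.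
by case: asboolP.
Qed.

(** Sorting puts the entries of modulus [v] side by side: the successor of the first one is squeezed
    between it and a later entry of modulus [v]. *)
Lemma consecutive_same_norm s v :
  sorted (fun z w : R[i] => `|z| <= `|w|) s ->
  (1 < count (fun z => `|z| == v%:C)%R s)%N ->
  exists j, [/\ (j.+1 < size s)%N, `|nth 0 s j| = v%:C & `|nth 0 s j.+1| = v%:C].
Proof.
elim: s => [|x s IH] //= xs; case: eqP => [xv|_] /=; last first.
  by rewrite add0n => /(IH (path_sorted xs)) [j [? ? ?]]; exists j.+1.
rewrite add1n ltnS -has_count => /hasP[w ws /eqP wv]; exists 0%N.
case: s xs ws {IH} => [|y s] //= /andP[xy ys] ws; split=> //.
apply/eqP; rewrite eq_le -{2}xv xy andbT.
move: ws; rewrite inE => /orP[/eqP <-|ws]; first by rewrite wv.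
have tr : transitive (fun z w : R[i] => `|z| <= `|w|).
  by move=> ? ? ?; exact: le_trans.
by rewrite -wv; have /allP/(_ _ ws) := order_path_min tr ys.
Qed.

(** Both sides amount to an ordering having at least two entries of modulus [v], counted with
    repetition. *)
Lemma consecutive_rootsP h v : (exists s, root_ordering h s) ->
  (exists z w, [/\ consecutive_roots h z w, `|z| = v%:C & `|w| = v%:C]) <->
  (exists z w, [/\ z != w, h z = 0, h w = 0, `|z| = v%:C & `|w| = v%:C]) \/
  (exists z, mult2_root h z /\ `|z| = v%:C).
Proof.
move=> [s so]; split.
  move=> [z [w [[{so}s [j [[_ cs] js zE wE]] zv wv]]]].
  have rt x : x \in s -> h x = 0.
    by apply: contraTeq => hx; rewrite -has_pred1 has_count cs hx.
  have zs : z \in s by rewrite -zE mem_nth // ltnW.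
  have ws : w \in s by rewrite -wE mem_nth.
  have [zw|zw] := eqVneq z w; last by left; exists z, w; split=> //; apply: rt.
  right; exists z; split=> //.
  (* Equal neighbours at [j] and [j.+1] are two occurrences of [z], which only a root of
     multiplicity two has. *)
  have : (1 < count_mem z s)%N.
    rewrite -(cat_take_drop j s) count_cat (drop_nth 0) ?(ltnW js) //.
    by rewrite (drop_nth 0) // zE wE -zw /= eqxx; apply: leq_trans (leq_addl _ _).
  by rewrite cs (rt z zs) eqxx; case: asboolP.
have [ss cs] := so.
have two : (1 < count (fun z => `|z| == v%:C)%R s)%N ->
    exists z w, [/\ consecutive_roots h z w, `|z| = v%:C & `|w| = v%:C].
  move=> cnt; have [j [js jv jv']] := consecutive_same_norm _ v ss cnt.
  by exists (nth 0 s j), (nth 0 s j.+1); split=> //; exists s, j.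
have ms x : h x = 0 -> x \in s.
  by move=> hx; rewrite -has_pred1 has_count cs hx eqxx; case: ifP.
move=> [[z [w [zw hz hw zv wv]]]|[z [hz zv]]]; apply: two.
  rewrite -size_filter (_ : 2%N = size [:: z; w]) //; apply: uniq_leq_size.
    by rewrite /= inE zw.
  by move=> x; rewrite !inE mem_filter => /orP[] /eqP ->; rewrite ?zv ?wv eqxx ms.
have <- : count_mem z s = 2%N.
  by rewrite cs; have [_ [_ [_ _ _ -> _]]] := hz; rewrite eqxx; case: asboolP.
by apply: sub_count => x /eqP ->; rewrite zv.
Qed.

End RootOrdering.

(** * Points through which the trochoid passes more than twice *)

Section MultiplePoints.
Context {R : realType} (n m : nat) (b c : R[i]) (gamma : R).
Hypotheses (hn : (0 < n)%N) (hnm : coprime n m).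
Hypotheses (hc : c != 0) (hgamma : c = `|c| * expi gamma).
Implicit Types (v t : R) (z p : R[i]).

(** The [m]-th and [(n + 2m)]-th powers of [x / y] are 1, hence so is the [n]-th; a Bezout relation
    [k * n = l * m + 1] then gives [x / y = 1]. *)
Lemma expr_coprime_inj (K : fieldType) (x y : K) : y != 0 ->
  x ^+ (n + 2 * m) = y ^+ (n + 2 * m) -> x ^+ m = y ^+ m -> x = y.
Proof.
move=> y0 Enm Em; have yk k : y ^+ k != 0 by rewrite expf_neq0.
have rm : (x / y) ^+ m = 1 by rewrite expr_div_n Em divff.
have rn : (x / y) ^+ n = 1.
  have : (x / y) ^+ (n + 2 * m) = 1 by rewrite expr_div_n Enm divff.
  by rewrite exprD mulnC exprM rm expr1n mulr1.
have /coprimeP-/(_ hn) [[k l] /= E] := hnm.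
have {}E : (k * n = l * m + 1)%N.
  by rewrite -E addnC subnK // ltnW // -subn_gt0 E.
have : (x / y) ^+ (k * n) = 1 by rewrite mulnC exprM rn expr1n.
rewrite E exprD mulnC exprM rm expr1n mul1r expr1 => /eqP.
rewrite -subr_eq0 -(divff y0) -mulrBl mulf_eq0.
by rewrite invr_eq0 (negPf y0) orbF subr_eq0 => /eqP.
Qed.

(* Eliminating the conjugate of [x] from the equations of the two circles leaves a
   quadratic equation in [x], with leading coefficient the conjugate of [- p]. *)
Lemma circles_meet (p a d : R[i]) (s : seq R[i]) : p != 0 -> uniq s ->
  (forall x, x \in s -> `|x| = a /\ `|p - x| = d) -> (size s <= 2)%N.
Proof.
move=> p0 us H.
pose q := Poly [:: - a ^+ 2 * p; p * p^*%R + a ^+ 2 - d ^+ 2; - p^*%R].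
have q0 : q != 0.
  apply/eqP => /(congr1 (fun r : {poly R[i]} => r`_2)).
  rewrite coef_Poly coef0 /= => /eqP.
  by rewrite oppr_eq0 conjC_eq0 (negPf p0).
suff : all (root q) s.
  by move=> /(max_poly_roots q0)/(_ us) /leq_trans/(_ (size_Poly _)).
apply/allP => x /H[xa xd]; rewrite /root horner_Poly /= -xa -xd.
by rewrite !normCK rmorphB; apply/eqP; ring.
Qed.

(** The first term [X t] lies on a circle about 0 and on one about [p], with radii independent of
    [t]; for [p != 0] this leaves at most two values of [X t]. *)
Lemma triple_point_origin v (s : seq R) p : 0 < v -> uniq s -> (2 < size s)%N ->
  (forall t, t \in s -> 0 <= t < 2 * pi /\ trochoid n m c gamma v t = p) -> p = 0.
Proof.
move=> v0 us ss H; apply/eqP; apply: contraLR ss => p0.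
have V0 : v%:C != 0 :> R[i] by rewrite fmorph_eq0 gt_eqF.
have c0 : `|c| * v%:C ^- m != 0 by rewrite mulf_neq0 ?normr_eq0 // invr_neq0 ?expf_neq0.
pose X t := v%:C ^+ n * expi ((n + 2 * m)%:R * t).
rewrite -leqNgt -(size_map X).
apply: (circles_meet p `|v%:C ^+ n| `|(`|c| * v%:C ^- m)|) => //.
  (* Distinct parameters give distinct [X t]: equal first terms with equal sums have equal second
     terms, so [expi t] and [expi u] agree in both powers [n + 2 * m] and [m]. *)
  rewrite map_inj_in_uniq // => t u /H[tI tp] /H[uI up] E.
  apply: expi_inj => //; apply: expr_coprime_inj; first exact: expi_neq0.
    by rewrite -!expi_natM; apply: (mulfI (expf_neq0 n V0)).
  move: tp; rewrite -up /trochoid -![v%:C ^+ n * _]/(X _) E => /addrI /(mulfI c0).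
  by rewrite !expiD !expi_natM => /(mulfI (expi_neq0 _)).
move=> x /mapP[t /H[_ tp] ->]; rewrite -tp /trochoid addrAC -/(X t) subrr add0r.
by rewrite /X !(normrM _ (expi _)) !norm_expi !mulr1.
Qed.

Lemma more_than_two_rootsP v : 0 < v ->
  more_than_two_roots (trinomial n m b c) v <->
  exists k, (2 < k)%N /\ multiple_point (trochoid n m c gamma v) k (- b).
Proof.
move=> v0; have V0 : v%:C != 0 :> R[i] by rewrite fmorph_eq0 gt_eqF.
split=> [[s [us ss H]]|[k [k2 [s [us sk H]]]]].
  have [r rE] : exists r : seq R, s = [seq v%:C * expi t | t <- r] /\
      forall t, t \in r -> 0 <= t < 2 * pi.
    elim: s H {us ss} => [|z s IH] H; first by exists [::].
    have [w ws|r [-> rI]] := IH; first by apply: H; rewrite inE ws orbT.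
    have [_ zv] := H z (mem_head z s); have [t tI ->] := polarP v z v0 zv.
    by exists (t :: r); split=> // u; rewrite inE => /orP[/eqP ->|/rI].
  case: rE H us ss => -> rI H us; rewrite size_map => ss.
  exists (size r); split=> //; exists r; split=> //; first exact: map_uniq us.
  move=> t tr; split; first exact: rI.
  by have [h0 _] := H _ (map_f _ tr); apply/(trinomial_eq0 n m b c gamma).
exists [seq v%:C * expi t | t <- s]; rewrite size_map sk; split=> //.
  rewrite map_inj_in_uniq // => t u /H[tI _] /H[uI _] /(mulfI V0).
  exact: expi_inj.
move=> z /mapP[t /H[_ tT] ->]; rewrite norm_polar //; split=> //.
exact/(trinomial_eq0 n m b c gamma).
Qed.

End MultiplePoints.

(** * The rose at the radius where both terms have equal modulus *)

Section Rose.
Context {R : realType} (n m : nat) (c : R[i]) (gamma : R).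
Hypothesis hn : (0 < n)%N.
Implicit Types (v t u a d : R) (z p : R[i]).

Lemma expi_sum a d : expi (a + d) + expi (a - d) = (2 * cos d)%:C * expi a.
Proof. by rewrite /expi cosB sinB cosD sinD; simpc; congr Complex; ring. Qed.

Lemma trochoid_balanced v t : 0 < v -> v%:C ^+ (n + m) = `|c| ->
  trochoid n m c gamma v t
  = v%:C ^+ n * (expi ((n + 2 * m)%:R * t) + expi (gamma + m%:R * t)).
Proof.
move=> v0 vc; rewrite /trochoid -vc exprD mulfK -?mulrDr //.
by rewrite expf_neq0 // fmorph_eq0 gt_eqF.
Qed.

(** Both frequencies are integers, which permits reducing parameters to one period. *)
Lemma trochoid_periodic v t u : expi t = expi u ->
  trochoid n m c gamma v t = trochoid n m c gamma v u.
Proof. by move=> E; rewrite /trochoid !expiD !expi_natM E. Qed.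

Lemma balanced_rhodonea v : 0 < v -> v%:C ^+ (n + m) = `|c| ->
  rhodonea (trochoid n m c gamma v).
Proof.
move=> v0 vc.
(* The sum has argument [theta t] and amplitude the cosine of
   [((n + m) t - gamma) / 2], an affine function of [theta t] of slope [k]
   vanishing at [theta t = t0]. *)
pose k : R := (n + m)%:R / (n + 3 * m)%:R.
have nm1 : (n + m)%:R != 0 :> R by rewrite pnatr_eq0 addn_eq0; case: n hn.
have nm3 : (n + 3 * m)%:R != 0 :> R by rewrite pnatr_eq0 addn_eq0; case: n hn.
have k0 : 0 < k by rewrite divr_gt0 // lt0r ?nm1 ?nm3 ler0n.
pose t0 := gamma * (1 + k) / (2 * k).
pose theta t := ((n + 3 * m)%:R * t + gamma) / 2.
have polar t : trochoid n m c gamma v t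
    = (2 * v ^+ n * cos (k * (theta t - t0)))%:C * expi (theta t - t0 + t0).
  have -> : k * (theta t - t0) = ((n + m)%:R * t - gamma) / 2.
    rewrite /theta /t0 /k; move: nm1 nm3; rewrite !(natrD _ n) (natrM _ 3) => nm1 nm3.
    by field; rewrite nm1 nm3.
  rewrite trochoid_balanced // subrK -mulrA (mulrCA 2) rmorphM rmorphXn.
  rewrite -mulrA -expi_sum; congr (_ * (expi _ + expi _)); rewrite /theta !(natrD _ n).
    by rewrite (natrM _ 2) (natrM _ 3); field.
  by rewrite (natrM _ 3); field.
exists (2 * v ^+ n), k, t0; split=> //; first by rewrite mulr_gt0 // exprn_gt0.
apply/seteqP; split=> _ /= [t tI <-]; first by rewrite polar; eexists.
(* For the other inclusion, the argument is the solution of [theta = t + t0], brought back into one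
   period. *)
have [u uI uE] := expi_reduce ((2 * (t + t0) - gamma) / (n + 3 * m)%:R).
exists u => //; rewrite (trochoid_periodic _ _ _ (esym uE)) polar /theta.
rewrite (mulrC (n + 3 * m)%:R) divfK // subrK (mulrC 2 (t + t0)).
by rewrite mulfK ?addrK ?pnatr_eq0.
Qed.

(** The two terms cancel exactly when [expi ((n + m) t) = - expi gamma], an equation with [n + m]
    equally spaced solutions in a period. *)
Lemma balanced_multiple_point v : 0 < v -> v%:C ^+ (n + m) = `|c| ->
  multiple_point (trochoid n m c gamma v) (n + m) 0.
Proof.
move=> v0 vc; set N := (n + m)%N.
have N0 : 0 < N%:R :> R by rewrite ltr0n /N; case: n hn.
have N1 : N%:R != 0 :> R by rewrite gt_eqF.
have p0 : 0 < 2 * pi :> R by rewrite mulr_gt0 ?pi_gt0.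
have [y /andP[y0 y1] yE] := expi_reduce (gamma + pi).
exists [seq (y + 2 * pi * j%:R) / N%:R | j <- iota 0 N].
rewrite size_map size_iota; split=> //.
  rewrite map_inj_in_uniq ?iota_uniq // => i j _ _ /(mulIf (invr_neq0 N1)).
  by move=> /addrI /(mulfI (lt0r_neq0 p0)) /eqP; rewrite eqr_nat => /eqP.
move=> t /mapP[j jN tE]; split.
  rewrite tE divr_ge0 ?ler0n ?addr_ge0 ?mulr_ge0 ?ler0n ?pi_ge0 //=.
  rewrite ltr_pdivrMr //.
  (* As [y < 2 * pi], the numerator is below [2 * pi * j.+1], hence below [2 * pi * N]. *)
  have : j.+1%:R <= N%:R :> R by rewrite ler_nat; rewrite mem_iota add0n in jN.
  by rewrite -natr1; nra.
have Nt : expi (N%:R * t) = - expi gamma.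
  rewrite tE mulrC divfK // expiD mulrC (mulrC _ j%:R) expi_natM expi_2pi expr1n.
  by rewrite mul1r -yE expiD expi_pi mulrN1.
rewrite trochoid_balanced // (_ : (n + 2 * m)%N = (N + m)%N); last first.
  by rewrite /N -addnA mul2n addnn.
by rewrite natrD mulrDl !expiD Nt mulNr addNr mulr0.
Qed.

(** The root is extracted in [R[i]], where it is positive and therefore equal to its real part. *)
Lemma balanced_radius : c != 0 -> exists2 v, 0 < v & v%:C ^+ (n + m) = `|c|.
Proof.
move=> c0; have N0 : (0 < n + m)%N by rewrite addn_gt0 hn.
have x0 : 0 < (n + m).-root `|c| by rewrite rootC_gt0 // normr_gt0.
have xE := RRe_real (gtr0_real x0).
exists (complex.Re ((n + m).-root `|c|)); first by rewrite -ltcR xE.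
by rewrite xE rootCK.
Qed.

Lemma balanced_norm v z : (`|z| = v%:C) -> trinomial n m 0 c z = 0 ->
  v%:C ^+ (n + m) = `|c|.
Proof.
move=> <-; rewrite /trinomial mul0r addr0 => /eqP.
by rewrite addr_eq0 -normrX => /eqP ->; rewrite normrN.
Qed.

End Rose.

(** * Roots of equal modulus and singular points of the trochoid *)

Theorem theorem2p11 (R : realType) (n m : nat) (b c : R[i]) (gamma v : R)
    (hn : (0 < n)%N) (hm : (0 < m)%N) (hnm : coprime n m)
    (hc : c != 0) (hgamma : c = `|c| * expi gamma) (hv : 0 < v) :
  let h := trinomial n m b c in
  let T := trochoid n m c gamma in
  ((exists z w : R[i],
      [/\ consecutive_roots h z w, `|z| = v%:C & `|w| = v%:C])
   <-> singular_point (T v) (- b)) /\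
  [/\
      (exists z w : R[i],
         [/\ z != w, h z = 0, h w = 0, `|z| = v%:C & `|w| = v%:C])
      <-> double_point (T v) (- b),
      (exists z : R[i], mult2_root h z /\ `|z| = v%:C)
      <-> (exists t : R,
             [/\ 0 <= t < 2 * pi, cusp_at (T v) (- b) t
               & b = (n + m)%:R / m%:R * v%:C ^+ n * expi ((n + 2 * m)%:R * t)])
    &
      (m < n)%N ->
      (* for the given v, when v is the modulus of a root *)
      ((exists z : R[i], h z = 0 /\ `|z| = v%:C) ->
         (more_than_two_roots h v <-> b = 0) /\
         (b = 0 <-> rose_at_origin (T v) (n + m) b)) /\
      (* for some modulus *)
      ((exists w : R, 0 < w /\ more_than_two_roots h w) <-> b = 0) /\
      (b = 0 <-> exists w : R, 0 < w /\ rose_at_origin (T w) (n + m) b)].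
Proof.
move=> h T.
have dbl := double_root_point n m b c gamma hgamma v hv.
have mlt := mult2_root_cusp n m b c gamma hgamma v hv.
have fin := root_ordering_exists _ (trinomial_finite_roots n m b c hn).
split.
  rewrite (consecutive_rootsP _ _ fin) /singular_point -dbl -mlt.
  by split=> -[]; [left | right | left | right].
split; first exact: dbl.
  rewrite mlt; split=> -[t]; last by case=> ? ? _; exists t.
  move=> [tI tc]; exists t; split=> //; exact: (cusp_value n m b c gamma).
(* An [(n + m)]-fold point is at least triple, so it must be the origin; placed at [- b], it forces
   [b = 0]. *)
move=> mn; have nm2 : (2 < n + m)%N.
  by apply: leq_trans (leq_add mn hm); rewrite addn1 !ltnS.
have point_b0 w k : 0 < w -> (2 < k)%N -> multiple_point (T w) k (- b) -> b = 0.
  move=> w0 k2 [s [us ss H]]; apply/eqP; rewrite -oppr_eq0; apply/eqP.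
  by apply: (triple_point_origin n m c gamma hn hnm hc w s) => //; rewrite ss.
have more_b0 w : 0 < w -> more_than_two_roots h w -> b = 0.
  move=> w0 /(more_than_two_rootsP n m b c gamma hgamma w w0) [k [k2]].
  exact: point_b0.
have rose_b0 w : 0 < w -> rose_at_origin (T w) (n + m) b -> b = 0.
  by move=> w0 [_ _]; exact: point_b0.
have b0_rose w : 0 < w -> w%:C ^+ (n + m) = `|c| -> b = 0 ->
    rose_at_origin (T w) (n + m) b.
  move=> w0 wc ->; have M := balanced_multiple_point n m c gamma hn w w0 wc.
  split; rewrite ?oppr0 //; exact: balanced_rhodonea.
have rose_more w : 0 < w -> rose_at_origin (T w) (n + m) b ->
    more_than_two_roots h w.
  move=> w0 [_ _ M]; apply/(more_than_two_rootsP n m b c gamma hgamma w w0).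
  by exists (n + m)%N.
(* This radius is the witness for the existential statements when [b = 0]. *)
have [w w0 wc] := balanced_radius n m c hn hc.
split=> [[z [hz zv]]|].
  (* When [b = 0] every root satisfies [z ^+ (n + m) = - c], so its modulus [v] is the balanced
     radius. *)
  have vc : b = 0 -> v%:C ^+ (n + m) = `|c|.
    by move=> b0; apply: (balanced_norm n m c v z zv); move: hz; rewrite /h b0.
  split; split; try exact: more_b0; try exact: rose_b0.
    by move=> b0; apply: rose_more => //; apply: b0_rose => //; exact: vc.
  by move=> b0; apply: b0_rose => //; exact: vc.
split; split.
- by move=> [u [u0]]; exact: more_b0.
- by move=> b0; exists w; split=> //; apply: rose_more => //; exact: b0_rose.
- by move=> b0; exists w; split=> //; exact: b0_rose.
- by move=> [u [u0]]; exact: rose_b0.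
Qed.
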